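(* Fix $d,k\in\mathbb N$ and let $A\in\mathbb R^{d^k\times d^k}$ be positive semidefinite. Let $x=x_1\otimes\cdots\otimes x_k$, where $x_1,\dots,x_k\in\mathbb R^d$ are independent and each is either a Rademacher vector or a $\mathcal N(0,I_d)$ Gaussian vector. Then $\operatorname{Var}[x^\top Ax]\le(3^k\operatorname{tr}(A))^2$.
   Context: A Rademacher vector has iid entries uniform on $\{\pm1\}$; $\otimes$ is the Kronecker product. *)

(* Defs.v *)
From HB Require Import structures.
From mathcomp Require Import all_boot all_order all_algebra.
From mathcomp Require Import mxtens.
From mathcomp Require Import all_classical all_reals all_analysis.
Set Implicit Arguments. Unset Strict Implicit. Unset Printing Implicit Defensive.
Import Order.TTheory GRing.Theory Num.Theory.
Local Open Scope classical_set_scope.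
Local Open Scope ring_scope.

(* Iterated Kronecker product x_0 ⊗ x_1 ⊗ ... ⊗ x_(k-1) of column vectors,
   using MathComp's Kronecker product [tensmx] (standard index order). *)
Fixpoint kronv (R : pzRingType) (d k : nat) : ('I_k -> 'cV[R]_d) -> 'cV[R]_(d ^ k) :=
  match k return ('I_k -> 'cV[R]_d) -> 'cV[R]_(d ^ k) with
  | 0 => fun _ => castmx (esym (expn0 d), erefl 1%N) (1%:M : 'M[R]_1)
  | k'.+1 => fun x =>
      castmx (esym (expnS d k'), muln1 1)
             (tensmx (x ord0) (kronv (fun i : 'I_k' => x (lift ord0 i))))
  end.

Definition psd (R : realDomainType) (n : nat) (A : 'M[R]_n) : Prop :=
  A^T = A /\ forall v : 'cV[R]_n, 0 <= (v^T *m A *m v) 0 0.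

Definition mutually_independent (R : realType) (dT : measure_display)
    (T : measurableType dT) (P : probability T R) (I : finType) (Y : I -> T -> R) : Prop :=
  forall B : I -> set R, (forall i, measurable (B i)) ->
    P (\bigcap_(i in [set: I]) (Y i @^-1` B i)) = (\prod_(i : I) P (Y i @^-1` B i))%E.

Definition rademacher (R : realType) (dT : measure_display)
    (T : measurableType dT) (P : probability T R) (Y : T -> R) : Prop :=
  P (Y @^-1` [set 1]) = (1 / 2)%:E /\ P (Y @^-1` [set -1]) = (1 / 2)%:E.

Definition std_gaussian (R : realType) (dT : measure_display)
    (T : measurableType dT) (P : probability T R) (Y : T -> R) : Prop :=
  forall B : set R, measurable B -> P (Y @^-1` B) = normal_prob 0 1 B.

(* Main.v *)
(* Bound the variance of [Q = x^T A x] by [E Q^2], the sum over p, q, r, s of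
   [A_pq A_rs E(x_p x_q x_r x_s)].  The mixed moments factor over the k tensor
   components, and each factor is nonnegative and at most the number of ways in
   which the corresponding digits of p, q, r, s match in pairs, which is its value
   for Gaussian components.  Since [A] is positive semidefinite,
   [|A_pq| <= a_p a_q] for [a_p = sqrt A_pp], so that [E Q^2] is at most the
   4-linear form with kernel the number of matchings, evaluated at [a].  In one
   component Cauchy-Schwarz bounds this form by 3 times the product of the l2
   norms, and such bounds multiply under tensor products, so that
   [E Q^2 <= 3^k |a|^4 = 3^k (tr A)^2]. *)

Require Import Defs.
From mathcomp Require Import all_boot all_order all_algebra.
From mathcomp Require Import mxtens.
From mathcomp Require Import all_classical all_reals all_analysis.
From mathcomp Require Import measurable_realfun ring lra zify.
Set Implicit Arguments. Unset Strict Implicit. Unset Printing Implicit Defensive.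
Import Order.TTheory GRing.Theory Num.Theory.
Import numFieldNormedType.Exports.
Local Open Scope classical_set_scope.
Local Open Scope ring_scope.

(** * Four-index kernels bounded in l2 *)

Section l2norm.
Context {R : rcfType}.

Definition l2norm {I : finType} (a : I -> R) : R := Num.sqrt (\sum_i a i ^+ 2).

Lemma l2norm_ge0 (I : finType) (a : I -> R) : 0 <= l2norm a.
Proof. exact: sqrtr_ge0. Qed.

Lemma sqr_l2norm (I : finType) (a : I -> R) : l2norm a ^+ 2 = \sum_i a i ^+ 2.
Proof. by rewrite sqr_sqrtr// sumr_ge0// => i _; rewrite sqr_ge0. Qed.

Lemma cauchy_schwarz (I : finType) (a b : I -> R) :
  `|\sum_i a i * b i| <= l2norm a * l2norm b.
Proof.
rewrite -ler_sqr ?nnegrE ?mulr_ge0 ?l2norm_ge0// real_normK ?num_real//.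
rewrite exprMn !sqr_l2norm -subr_ge0.
have lagrange : \sum_i \sum_j (a i * b j - a j * b i) ^+ 2 =
    2 * ((\sum_i a i ^+ 2) * (\sum_j b j ^+ 2) - (\sum_i a i * b i) ^+ 2).
  rewrite mulrBr mulr_natl mulr2n {2}[_ * \sum_j _]mulrC expr2 !big_distrlr/=.
  rewrite mulr_sumr -sumrN -!big_split/=; apply: eq_bigr => i _.
  rewrite mulr_sumr -sumrN -!big_split/=; apply: eq_bigr => j _; ring.
rewrite -(@pmulr_rge0 _ 2)// -lagrange.
by apply: sumr_ge0 => i _; apply: sumr_ge0 => j _; exact: sqr_ge0.
Qed.

Lemma l2norm_pair (I J : finType) (a : I * J -> R) :
  l2norm (fun i => l2norm (fun j => a (i, j))) = l2norm a.
Proof.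
rewrite {1}/l2norm; under eq_bigr do rewrite sqr_l2norm.
by rewrite pair_big /l2norm; under eq_bigr do rewrite -surjective_pairing.
Qed.

Lemma l2norm_bij (I J : finType) (h : J -> I) (a : I -> R) :
  bijective h -> l2norm (a \o h) = l2norm a.
Proof. by move=> bij_h; rewrite /l2norm [in RHS](reindex h)//; exact: onW_bij. Qed.

End l2norm.

Section sum4.
Context {R : comPzRingType}.

Definition sum4 {I : finType} (H : I -> I -> I -> I -> R) : R :=
  \sum_(u : I * I * I * I) H u.1.1.1 u.1.1.2 u.1.2 u.2.

Lemma sum4_distrlr (I : finType) (F G : I -> I -> R) :
  (\sum_p \sum_q F p q) * (\sum_r \sum_s G r s) =
  sum4 (fun p q r s => F p q * G r s).
Proof.
rewrite !pair_bigA big_distrlr pair_bigA /sum4/=.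
rewrite (reindex (fun u : I * I * I * I => ((u.1.1.1, u.1.1.2), (u.1.2, u.2))))//=.
by exists (fun v => (v.1.1, v.1.2, v.2.1, v.2.2)) => [[[[p q] r] s]|[[p q] [r s]]] _.
Qed.

Lemma sum4_swap23 (I : finType) (H : I -> I -> I -> I -> R) :
  sum4 H = sum4 (fun p r q s => H p q r s).
Proof.
rewrite /sum4 (reindex_inj (h := fun u => (u.1.1.1, u.1.2, u.1.1.2, u.2)))//.
by apply: inv_inj => -[[[p q] r] s].
Qed.

Lemma sum4_swap24 (I : finType) (H : I -> I -> I -> I -> R) :
  sum4 H = sum4 (fun p s r q => H p q r s).
Proof.
rewrite /sum4 (reindex_inj (h := fun u => (u.1.1.1, u.2, u.1.2, u.1.1.2)))//.
by apply: inv_inj => -[[[p q] r] s].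
Qed.

Lemma sum4_pair (I J : finType) (H : I * J -> I * J -> I * J -> I * J -> R) :
  sum4 H = sum4 (fun i1 i2 i3 i4 => sum4 (fun j1 j2 j3 j4 =>
    H (i1, j1) (i2, j2) (i3, j3) (i4, j4))).
Proof.
rewrite /sum4 pair_bigA/=.
rewrite [LHS](reindex (fun uv : (I * I * I * I) * (J * J * J * J) =>
  ((uv.1.1.1.1, uv.2.1.1.1), (uv.1.1.1.2, uv.2.1.1.2),
   (uv.1.1.2, uv.2.1.2), (uv.1.2, uv.2.2))))//=.
exists (fun w => ((w.1.1.1.1, w.1.1.2.1, w.1.2.1, w.2.1),
                  (w.1.1.1.2, w.1.1.2.2, w.1.2.2, w.2.2))).
  by move=> [[[[i1 i2] i3] i4] [[[j1 j2] j3] j4]] _.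
by move=> [[[[i1 j1] [i2 j2]] [i3 j3]] [i4 j4]] _.
Qed.

Lemma sum4_bij (I J : finType) (h : J -> I) (H : I -> I -> I -> I -> R) :
  bijective h -> sum4 H = sum4 (fun p q r s => H (h p) (h q) (h r) (h s)).
Proof.
move=> [g hK gK]; rewrite /sum4.
rewrite (reindex (fun u => (h u.1.1.1, h u.1.1.2, h u.1.2, h u.2)))//=.
exists (fun u => (g u.1.1.1, g u.1.1.2, g u.1.2, g u.2)).
  by move=> [[[p q] r] s] _; rewrite /= !hK.
by move=> [[[p q] r] s] _; rewrite /= !gK.
Qed.

End sum4.

Section pairings.
Context {R : numDomainType}.

Definition pairings {I : finType} (p q r s : I) : R :=
  ((p == q) && (r == s))%:R + ((p == r) && (q == s))%:R + ((p == s) && (q == r))%:R.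

Lemma pairings_ge0 (I : finType) (p q r s : I) : 0 <= pairings p q r s.
Proof. by rewrite /pairings !addr_ge0. Qed.

End pairings.

Section l2_bounded.
Context {R : rcfType}.

Definition l2_bounded {I : finType} (C : R) (K : I -> I -> I -> I -> R) : Prop :=
  forall a b c e : I -> R,
    sum4 (fun p q r s => K p q r s * (a p * b q * c r * e s)) <=
    C * (l2norm a * l2norm b * l2norm c * l2norm e).

Lemma l2_bounded_bij (I J : finType) (h : J -> I) (C : R) (K : I -> I -> I -> I -> R) :
  bijective h ->
  l2_bounded C (fun p q r s => K (h p) (h q) (h r) (h s)) -> l2_bounded C K.
Proof.
move=> bij_h Kh a b c e; rewrite (sum4_bij _ bij_h).
by rewrite -!(l2norm_bij _ bij_h); exact: Kh.
Qed.

Lemma l2_bounded_tensor (I J : finType) (C D : R)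
    (K : I -> I -> I -> I -> R) (L : J -> J -> J -> J -> R) :
  (forall p q r s, 0 <= K p q r s) -> 0 <= D ->
  l2_bounded C K -> l2_bounded D L ->
  l2_bounded (C * D) (fun p q r s => K p.1 q.1 r.1 s.1 * L p.2 q.2 r.2 s.2).
Proof.
move=> K_ge0 D_ge0 K_bounded L_bounded a b c e; rewrite sum4_pair.
pose norms (x : I * J -> R) i := l2norm (fun j => x (i, j)).
apply: (@le_trans _ _ (D * sum4 (fun p q r s =>
    K p q r s * (norms a p * norms b q * norms c r * norms e s)))).
  rewrite /sum4 mulr_sumr; apply: ler_sum => -[[[p q] r] s] _ /=.
  rewrite mulrCA; under eq_bigr do rewrite -mulrA.
  by rewrite -mulr_sumr ler_wpM2l//; exact: L_bounded.
rewrite [C * D]mulrC -[leRHS]mulrA; apply: ler_wpM2l => //.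
by rewrite -(l2norm_pair a) -(l2norm_pair b) -(l2norm_pair c) -(l2norm_pair e).
Qed.

Lemma l2_bounded_ord1 : l2_bounded 1 (fun _ _ _ _ : 'I_1 => 1).
Proof.
have l2norm1 (a : 'I_1 -> R) : l2norm a = `|a 0|.
  by rewrite /l2norm big_ord1 sqrtr_sqr.
move=> a b c e; rewrite /sum4 (bigD1 (0, 0, 0, 0))//= big1 => [|u]; last first.
  by move: u => [[[p q] r] s]; rewrite !ord1 eqxx.
by rewrite !mul1r addr0 !l2norm1 -!normrM ler_norm.
Qed.

Lemma sum_diagonal (I : finType) (a b : I -> R) :
  \sum_p \sum_q (p == q)%:R * (a p * b q) = \sum_p a p * b p.
Proof.
apply: eq_bigr => p _; rewrite (bigD1 p)//= eqxx mul1r big1 ?addr0// => q qp.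
by rewrite eq_sym (negbTE qp) mul0r.
Qed.

Lemma sum4_pairings (I : finType) (a b c e : I -> R) :
  sum4 (fun p q r s => pairings p q r s * (a p * b q * c r * e s)) =
  (\sum_p a p * b p) * (\sum_r c r * e r) + (\sum_p a p * c p) * (\sum_q b q * e q)
  + (\sum_p a p * e p) * (\sum_q c q * b q).
Proof.
rewrite -!sum_diagonal !sum4_distrlr.
rewrite [X in _ + X + _]sum4_swap23 [X in _ + X]sum4_swap24 /sum4 -!big_split/=.
apply: eq_bigr => -[[[p q] r] s] _ /=.
by rewrite /pairings -!mulnb !natrM [r == q]eq_sym; ring.
Qed.

Lemma l2_bounded_pairings (I : finType) : l2_bounded 3 (@pairings R I).
Proof.
move=> a b c e; rewrite sum4_pairings.
have dot2_le (x y z w : I -> R) : (\sum_i x i * y i) * (\sum_i z i * w i) <=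
    l2norm x * l2norm y * (l2norm z * l2norm w).
  by rewrite (le_trans (ler_norm _))// normrM ler_pM ?cauchy_schwarz.
have := dot2_le a b c e; have := dot2_le a c b e; have := dot2_le a e c b.
set x := _ * \sum_i _; set y := _ * \sum_i _; set z := _ * \sum_i _; lra.
Qed.

End l2_bounded.

(** * Coordinates of a Kronecker product *)

Section digits.
Context {d : nat}.

Definition digit_cons {k} (jp : 'I_d * 'I_(d ^ k)) : 'I_(d ^ k.+1) :=
  cast_ord (esym (expnS d k)) (mxtens_index jp).

Definition digit_uncons {k} (p : 'I_(d ^ k.+1)) : 'I_d * 'I_(d ^ k) :=
  mxtens_unindex (cast_ord (expnS d k) p).

Lemma digit_consK k : cancel (@digit_cons k) digit_uncons.
Proof. by move=> jp; rewrite /digit_uncons cast_ordKV mxtens_indexK. Qed.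

Lemma digit_unconsK k : cancel (@digit_uncons k) digit_cons.
Proof. by move=> p; rewrite /digit_cons mxtens_unindexK cast_ordK. Qed.

Lemma digit_cons_bij k : bijective (@digit_cons k).
Proof. by exists digit_uncons; [exact: digit_consK|exact: digit_unconsK]. Qed.

(* The base-[d] digits of [p], most significant first, the order in which [kronv]
   multiplies its factors. *)
Fixpoint digit {k} : 'I_(d ^ k) -> 'I_k -> 'I_d :=
  match k with
  | 0 => fun _ i => match i with Ordinal m m_lt0 => False_rect _ (notF m_lt0) end
  | k'.+1 => fun p i =>
      if unlift ord0 i is Some i' then digit (digit_uncons p).2 i' else (digit_uncons p).1
  end.

Lemma digitS k (p : 'I_(d ^ k.+1)) i : digit p i =
  if unlift ord0 i is Some i' then digit (digit_uncons p).2 i' else (digit_uncons p).1.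
Proof. by []. Qed.

Lemma digit_cons0 k (jp : 'I_d * 'I_(d ^ k)) : digit (digit_cons jp) ord0 = jp.1.
Proof. by rewrite digitS unlift_none digit_consK. Qed.

Lemma digit_consS k (jp : 'I_d * 'I_(d ^ k)) i :
  digit (digit_cons jp) (lift ord0 i) = digit jp.2 i.
Proof. by rewrite digitS liftK digit_consK. Qed.

Lemma kronvE (R : comPzRingType) k (x : 'I_k -> 'cV[R]_d) (p : 'I_(d ^ k)) :
  kronv x p 0 = \prod_i x i (digit p i) 0.
Proof.
elim: k x p => [|k IHk] x p; first by rewrite big_ord0 /= castmxE !ord1 mxE eqxx.
rewrite -[p]digit_unconsK big_ord_recl digit_cons0.
under eq_bigr do rewrite digit_consS.
rewrite -IHk [LHS]castmxE mxE esymK /digit_cons cast_ordKV mxtens_indexK.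
set z := mxtens_unindex (cast_ord _ 0).
by rewrite (ord1 z.1) (ord1 z.2).
Qed.

Lemma l2_bounded_digit_pairings (R : rcfType) k :
  l2_bounded (3 ^+ k : R) (fun p q r s : 'I_(d ^ k) =>
    \prod_i pairings (digit p i) (digit q i) (digit r i) (digit s i)).
Proof.
elim: k => [|k IHk].
  move=> a b c e; rewrite /sum4; under eq_bigr do rewrite big_ord0.
  exact: l2_bounded_ord1.
apply: (l2_bounded_bij (digit_cons_bij k)) => a b c e; rewrite exprS /sum4.
under eq_bigr => u _.
  rewrite big_ord_recl !digit_cons0; under eq_bigr do rewrite !digit_consS.
  over.
apply: (l2_bounded_tensor (@pairings_ge0 _ _) _ (@l2_bounded_pairings _ _) IHk).
exact: exprn_ge0.
Qed.

End digits.

(** * Mixed moments of order four *)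

Section multiplicity.
Context {I : finType}.

Definition multiplicity (p q r s j : I) : nat :=
  ((p == j) + (q == j) + (r == j) + (s == j))%N.

Lemma multiplicity_le4 p q r s j : (multiplicity p q r s j <= 4)%N.
Proof. by rewrite /multiplicity; do 4 case: (_ == j). Qed.

Lemma prod_multiplicity (R : comPzRingType) (x : I -> R) p q r s :
  x p * x q * x r * x s = \prod_j x j ^+ multiplicity p q r s j.
Proof.
have xE i : x i = \prod_j x j ^+ (i == j).
  rewrite (bigD1 i)//= eqxx expr1 big1 ?mulr1// => j /negbTE ji.
  by rewrite eq_sym ji expr0.
under [RHS]eq_bigr do rewrite !exprD.
by rewrite !big_split/= -!xE.
Qed.

Lemma even_multiplicity_pairs p q r s :
  (forall j, ~~ odd (multiplicity p q r s j)) ->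
  [\/ p = q /\ r = s, p = r /\ q = s | p = s /\ q = r].
Proof.
rewrite /multiplicity => even_mult; have [pq|pq] := eqVneq p q.
  have := even_mult r; rewrite pq eqxx !oddD !oddb addbb.
  by case: eqVneq => // -> _; apply: Or31.
have [pr|pr] := eqVneq p r.
  have := even_mult q; rewrite -pr (negbTE pq) eqxx addn0.
  by case: eqVneq => // <- _; apply: Or32.
have := even_mult p.
rewrite eqxx [q == p]eq_sym (negbTE pq) [r == p]eq_sym (negbTE pr).
case: eqVneq => // sp _; have := even_mult q.
by rewrite sp eqxx (negbTE pq); case: eqVneq => // <- _; apply: Or33.
Qed.

Section mixed_moments.
Context {R : numDomainType}.
Variable mom : I -> nat -> R.
Hypotheses (mom0_eq1 : forall j, mom j 0 = 1) (mom1_eq0 : forall j, mom j 1 = 0).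
Hypotheses (mom2_ge0_le1 : forall j, 0 <= mom j 2 <= 1) (mom3_eq0 : forall j, mom j 3 = 0).
Hypothesis mom4_ge0_le3 : forall j, 0 <= mom j 4 <= 3.

Lemma prod_moments_ge0 p q r s : 0 <= \prod_j mom j (multiplicity p q r s j).
Proof.
apply: prodr_ge0 => j _; have := multiplicity_le4 p q r s j.
case: (multiplicity _ _ _ _ _) => [|[|[|[|[|]]]]]// _.
all: rewrite ?mom0_eq1 ?mom1_eq0 ?mom3_eq0//.
- by case/andP: (mom2_ge0_le1 j).
- by case/andP: (mom4_ge0_le3 j).
Qed.

Lemma prod_moments_odd p q r s j : odd (multiplicity p q r s j) ->
  \prod_i mom i (multiplicity p q r s i) = 0.
Proof.
move=> j_odd; rewrite (bigD1 j)//= (_ : mom j _ = 0) ?mul0r//.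
have := multiplicity_le4 p q r s j; move: j_odd.
by case: (multiplicity _ _ _ _ _) => [|[|[|[|[|]]]]].
Qed.

Lemma prod_moments_two_pairs p r (n : I -> nat) :
  (forall j, n j = (2 * (p == j) + 2 * (r == j))%N) ->
  \prod_j mom j (n j) <= if p == r then 3 else 1.
Proof.
move=> nE; rewrite (bigD1 p)//= nE eqxx; have [eq_pr|pr] := eqVneq p r.
  rewrite big1 ?mulr1 => [|j /negbTE jp]; first by case/andP: (mom4_ge0_le3 p).
  by rewrite nE -eq_pr eq_sym jp mom0_eq1.
rewrite (bigD1 r) 1?eq_sym//= nE eqxx (negbTE pr) big1 ?mulr1.
  have /andP[? ?] := mom2_ge0_le1 p; have /andP[? ?] := mom2_ge0_le1 r.
  exact: mulr_ile1.
by move=> j /andP[/negbTE jp /negbTE jr]; rewrite nE eq_sym jp eq_sym jr mom0_eq1.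
Qed.

Lemma prod_moments_le_pairings p q r s :
  \prod_j mom j (multiplicity p q r s j) <= pairings p q r s.
Proof.
have [/existsP[j j_odd]|] := boolP [exists j, odd (multiplicity p q r s j)].
  by rewrite (prod_moments_odd j_odd) pairings_ge0.
rewrite negb_exists => /forallP/even_multiplicity_pairs pairs.
suff [[a b] multE pairE] : exists2 ab : I * I,
    (forall j, multiplicity p q r s j = 2 * (ab.1 == j) + 2 * (ab.2 == j))%N &
    pairings p q r s = (if ab.1 == ab.2 then 3 else 1) :> R.
  by rewrite pairE; exact: prod_moments_two_pairs.
rewrite /multiplicity /pairings.
case: pairs => -[<- <-]; [exists (p, r)|exists (p, q)|exists (p, q)] => [j||j||j|] /=.
1,3,5: lia.
all: by rewrite !eqxx /=; case: eqVneq => _; rewrite /= ?addr0 ?add0r -?natrD.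
Qed.

End mixed_moments.

End multiplicity.

(** * Quadratic forms *)

Lemma quad_formE (R : comPzRingType) n (A : 'M[R]_n) (v : 'cV[R]_n) :
  (v^T *m A *m v) 0 0 = \sum_p \sum_q A p q * (v p 0 * v q 0).
Proof.
rewrite mxE exchange_big/=; apply: eq_bigr => q _.
rewrite mxE mulr_suml; apply: eq_bigr => p _.
by rewrite mxE; ring.
Qed.

Lemma sqr_quad_formE (R : comPzRingType) n (A : 'M[R]_n) (v : 'cV[R]_n) :
  ((v^T *m A *m v) 0 0) ^+ 2 = sum4 (fun p q r s =>
    A p q * A r s * (v p 0 * v q 0 * v r 0 * v s 0)).
Proof.
rewrite quad_formE expr2 sum4_distrlr.
by apply: eq_bigr => u _; ring.
Qed.

Lemma ge0_binary_form_discr_le (R : realDomainType) (a b c : R) :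
  (forall x y, 0 <= x ^+ 2 * a + 2 * (x * y * b) + y ^+ 2 * c) -> b ^+ 2 <= a * c.
Proof.
move=> form; have a0 := form 1 0; have [c0|c_neq0] := eqVneq c 0.
  by have := form b (- (a + 1)); rewrite c0 => h; nra.
have c_gt0 : 0 < c by rewrite lt_def c_neq0; have := form 0 1; lra.
have := form c (- b).
rewrite (_ : _ + _ = c * (a * c - b ^+ 2)); last by ring.
by rewrite pmulr_rge0// subr_ge0.
Qed.

Lemma psd_entry_sqr_le (R : realDomainType) n (A : 'M[R]_n) p q : psd A ->
  A p q ^+ 2 <= A p p * A q q.
Proof.
move=> [AT A0]; have Aqp : A q p = A p q by rewrite -{1}AT mxE.
apply: ge0_binary_form_discr_le => x y.
have := A0 (x *: delta_mx p 0 + y *: delta_mx q 0).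
have deltaE i j : (delta_mx 0 i *m A *m delta_mx j 0 : 'M[R]_1) 0 0 = A i j.
  by rewrite -rowE -colE !mxE.
rewrite [_^T]raddfD/= ![(_ *: _)^T]linearZ/= !trmx_delta !(mulmxDl, mulmxDr).
rewrite -!(scalemxAl, scalemxAr).
have addE (B C : 'M[R]_1) : (B + C) 0 0 = B 0 0 + C 0 0 by rewrite mxE.
have scaleE z (B : 'M[R]_1) : (z *: B) 0 0 = z * B 0 0 by rewrite mxE.
rewrite !(addE, scaleE, deltaE) Aqp; congr (0 <= _); ring.
Qed.

Lemma psd_diag_ge0 (R : realDomainType) n (A : 'M[R]_n) p : psd A -> 0 <= A p p.
Proof. by move=> /proj2/(_ (delta_mx p 0)); rewrite trmx_delta -rowE -colE !mxE. Qed.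

Lemma psd_entry_le (R : rcfType) n (A : 'M[R]_n) p q : psd A ->
  `|A p q| <= Num.sqrt (A p p) * Num.sqrt (A q q).
Proof.
move=> psdA; rewrite -sqrtrM ?psd_diag_ge0// -sqrtr_sqr.
by rewrite ler_wsqrtr// psd_entry_sqr_le.
Qed.

(** * Products of independent random variables *)

Lemma measurable_preimageT (d d' : measure_display) (T : measurableType d)
    (U : measurableType d') (f : T -> U) (B : set U) :
  measurable_fun setT f -> measurable B -> measurable (f @^-1` B).
Proof. by move=> mf mB; rewrite -[_ @^-1` _]setTI; exact: mf. Qed.

Section mean_sum.
Context {d : measure_display} {T : measurableType d} {R : realType}.
Variables (mu : {measure set T -> \bar R}) (D : set T).
Hypothesis mD : measurable D.

Lemma integrable_sum_EFin (J : Type) (s : seq J) (Q : pred J) (f : J -> T -> R) :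
  (forall j, mu.-integrable D (EFin \o f j)) ->
  mu.-integrable D (EFin \o (fun t => \sum_(j <- s | Q j) f j t)).
Proof.
move=> intf; rewrite (_ : _ \o _ = fun t => \sum_(j <- s | Q j) (f j t)%:E)%E.
  by apply: integrable_sum => // j _; exact: intf.
by apply/funext => t /=; rewrite sumEFin.
Qed.

Lemma Rintegral_sum (J : Type) (s : seq J) (Q : pred J) (f : J -> T -> R) :
  (forall j, mu.-integrable D (EFin \o f j)) ->
  \int[mu]_(t in D) (\sum_(j <- s | Q j) f j t) =
  \sum_(j <- s | Q j) \int[mu]_(t in D) f j t.
Proof.
move=> intf; elim: s => [|j s IHs].
  under eq_Rintegral do rewrite big_nil.
  by rewrite big_nil Rintegral_cst// mul0r.
under eq_Rintegral do rewrite big_cons.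
rewrite big_cons; case: (Q j) => //.
by rewrite RintegralD ?IHs//; exact: integrable_sum_EFin.
Qed.

Lemma cvg_integral_nondecreasing (f_ : (T -> R)^nat) (f : T -> R) :
  (forall n, measurable_fun D (f_ n)) -> (forall n t, D t -> 0 <= f_ n t) ->
  (forall t, D t -> {homo f_ ^~ t : n m / (n <= m)%N >-> n <= m}) ->
  (forall t, D t -> f_ n t @[n --> \oo] --> f t) ->
  (\int[mu]_(t in D) (f_ n t)%:E @[n --> \oo] --> \int[mu]_(t in D) (f t)%:E)%E.
Proof.
move=> mf f0 ndf cvgf.
rewrite (eq_integral (fun t => limn (fun n => (f_ n t)%:E))); last first.
  move=> t /set_mem Dt; apply/esym/cvg_lim => //.
  apply/cvg_EFin; first exact: nearW.
  exact: cvgf.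
apply: (@cvg_monotone_convergence _ _ _ mu _ mD (fun n t => (f_ n t)%:E)).
- by move=> n; exact/measurable_EFinP.
- by move=> n t Dt; rewrite lee_fin f0.
- by move=> t Dt n m nm; rewrite lee_fin ndf.
Qed.

End mean_sum.

Section independence.
Import HBNNSimple.
Context {R : realType} {dT : measure_display} {T : measurableType dT}.
Variables (P : probability T R) (I : finType) (Y : I -> T -> R).
Hypothesis mY : forall i, measurable_fun setT (Y i).
Hypothesis indepY : mutually_independent P Y.

Definition mean_factors (f : I -> R -> R) : Prop :=
  P.-integrable setT (EFin \o (fun t => \prod_i f i (Y i t))) /\
  \int[P]_t (\prod_i f i (Y i t)) = \prod_i \int[P]_t f i (Y i t).

Lemma mean_factors_indic (B : I -> set R) : (forall i, measurable (B i)) ->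
  mean_factors (fun i => \1_(B i)).
Proof.
move=> mB.
have mYB i : measurable (Y i @^-1` B i) by exact: measurable_preimageT.
have mcap : measurable (\bigcap_(i in [set: I]) Y i @^-1` B i).
  exact: fin_bigcap_measurable.
have prod_indic : (fun t => \prod_i \1_(B i) (Y i t)) =
    \1_(\bigcap_(i in [set: I]) Y i @^-1` B i) :> (T -> R).
  apply/funext => t; rewrite [RHS]indicE.
  case: (boolP (t \in _)) => [/set_mem tB|/negP tB].
    by rewrite big1// => i _; rewrite indicE mem_set//; exact: tB.
  have /existsNP[i tBi] : ~ forall i, B i (Y i t).
    by move=> tB'; apply: tB; apply/mem_set => i _; exact: tB'.
  by rewrite (bigD1 i)//= indicE memNset// mul0r.
rewrite /mean_factors prod_indic; split; first exact: integrable_indic.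
apply: EFin_inj; rewrite [in LHS]fineK ?integrable_fin_num//; last first.
  exact: integrable_indic.
rewrite integral_indic// setIT [LHS]indepY// -prodEFin; apply: eq_bigr => i _.
rewrite fineK ?integrable_fin_num//; last exact: (integrable_indic P (mYB i)).
by rewrite (integral_indic P measurableT (mYB i)) setIT.
Qed.

Lemma mean_factorsZ (a : I -> R) (f : I -> R -> R) :
  (forall i, P.-integrable setT (EFin \o (f i \o Y i))) ->
  mean_factors f -> mean_factors (fun i x => a i * f i x).
Proof.
move=> intf [intprod prodE]; rewrite /mean_factors.
under [X in EFin \o X]eq_fun do rewrite big_split.
under eq_Rintegral do rewrite big_split.
split; first exact: (integrableZl measurableT _ intprod).
rewrite RintegralZl// prodE -big_split; apply: eq_bigr => i _.
by rewrite RintegralZl//; exact: intf.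
Qed.

Lemma mean_factors_sum (J : finType) (f : I -> J -> R -> R) :
  (forall i j, P.-integrable setT (EFin \o (f i j \o Y i))) ->
  (forall h : {ffun I -> J}, mean_factors (fun i => f i (h i))) ->
  mean_factors (fun i x => \sum_j f i j x).
Proof.
move=> intf fprod; rewrite /mean_factors.
under [X in EFin \o X]eq_fun do rewrite bigA_distr_bigA.
under eq_Rintegral do rewrite bigA_distr_bigA.
split; first by apply: integrable_sum_EFin => // h; case: (fprod h).
rewrite Rintegral_sum//; last by move=> h; case: (fprod h).
under [RHS]eq_bigr => i _ do rewrite (Rintegral_sum _ _ _ (intf i))//.
by rewrite bigA_distr_bigA; apply: eq_bigr => h _; case: (fprod h).
Qed.

Lemma mean_factors_simple (f : I -> {nnsfun R >-> R}) :
  mean_factors (fun i => f i).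
Proof.
(* With a common finite set of values, the product of the sums expands over a
   single type of functions. *)
pose s := flatten [seq finmap.enum_fset (fset_set (range (f i))) | i <- enum I].
have f_s i x : f i x \in s.
  apply/flattenP; exists (finmap.enum_fset (fset_set (range (f i)))).
    exact/map_f/mem_enum.
  by rewrite in_fset_set ?inE//; exact: fimfunP.
pose g i (y : seq_sub s) x := val y * \1_(f i @^-1` [set val y]) x.
have mf i (y : seq_sub s) : measurable (f i @^-1` [set val y]).
  exact: measurable_funPTI.
have mfY i (y : seq_sub s) : measurable (Y i @^-1` (f i @^-1` [set val y])).
  exact: measurable_preimageT.
have intg i (y : seq_sub s) : P.-integrable setT (EFin \o (g i y \o Y i)).
  exact: (integrableZl measurableT _ (integrable_indic P (mfY i y))).
have -> : (fun i => f i : R -> R) = fun i x => \sum_y g i y x.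
  apply/funext => i; apply/funext => x.
  rewrite (bigD1 (SeqSub (f_s i x)))//= big1 ?addr0 => [|y /eqP yx].
    by rewrite /g indicE mem_set ?mulr1.
  by rewrite /g indicE memNset ?mulr0// => fy; apply: yx; exact: val_inj.
apply: mean_factors_sum => // h; apply: mean_factorsZ => [i|].
  exact: (integrable_indic P (mfY i (h i))).
exact: mean_factors_indic.
Qed.

Lemma mean_factors_nondecreasing (f_ : nat -> I -> R -> R) (f : I -> R -> R) :
  (forall n i, measurable_fun setT (f_ n i)) -> (forall n i x, 0 <= f_ n i x) ->
  (forall i x, {homo (fun n => f_ n i x) : n m / (n <= m)%N >-> n <= m}) ->
  (forall i x, f_ n i x @[n --> \oo] --> f i x) ->
  (forall i, P.-integrable setT (EFin \o (f i \o Y i))) ->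
  (forall n, mean_factors (f_ n)) -> mean_factors f.
Proof.
move=> mf_ f_0 ndf cvgf intf factf_.
have f0 i x : 0 <= f i x.
  rewrite -(cvg_lim _ (cvgf i x))//; apply: limr_ge; last exact: nearW.
  by apply/cvg_ex; exists (f i x).
have mfY n i : measurable_fun setT (f_ n i \o Y i) by exact: measurableT_comp.
have cvg_int i : \int[P]_t f_ n i (Y i t) @[n --> \oo] --> \int[P]_t f i (Y i t).
  apply: fine_cvg; rewrite fineK; last exact/integrable_fin_num/intf.
  by apply: cvg_integral_nondecreasing => // n; exact: mfY.
have int_prodE n : (\int[P]_t (\prod_i f_ n i (Y i t))%:E =
    (\prod_i \int[P]_t f_ n i (Y i t))%:E)%E.
  by have [intprod <-] := factf_ n; rewrite fineK ?integrable_fin_num.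
have int_prod : (\int[P]_t (\prod_i f i (Y i t))%:E =
    (\prod_i \int[P]_t f i (Y i t))%:E)%E.
  have cvg_mean : (\int[P]_t (\prod_i f_ n i (Y i t))%:E @[n --> \oo] -->
      \int[P]_t (\prod_i f i (Y i t))%:E)%E.
    apply: cvg_integral_nondecreasing => // [n|n t _|t _ n m nm|t _].
    - by apply: measurable_prod => i _; exact: mfY.
    - exact: prodr_ge0.
    - by apply: ler_prod => i _; rewrite f_0 ndf.
    - by apply: cvg_big => //; exact: mul_continuous.
  rewrite -(cvg_lim _ cvg_mean)//; under eq_fun do rewrite int_prodE.
  apply/cvg_lim => //; apply/cvg_EFin; first exact: nearW.
  by apply: cvg_big => //; exact: mul_continuous.
split; last by rewrite /Rintegral int_prod.
apply/integrableP; split.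
  apply/measurable_EFinP; apply: measurable_prod => i _.
  exact/measurable_EFinP/(measurable_int _ (intf i)).
under eq_integral do rewrite gee0_abs ?lee_fin ?prodr_ge0//.
by rewrite int_prod ltry.
Qed.

Lemma ge0_mean_factors (f : I -> R -> R) :
  (forall i, measurable_fun setT (f i)) -> (forall i x, 0 <= f i x) ->
  (forall i, P.-integrable setT (EFin \o (f i \o Y i))) -> mean_factors f.
Proof.
move=> mf f0 intf.
have mfE i : measurable_fun setT (EFin \o f i) by exact/measurable_EFinP.
pose f_ n i := nnsfun_approx measurableT (mfE i) n.
apply: (mean_factors_nondecreasing (f_ := f_)) => // [i x n m nm|i x|n].
- exact/lefP/nd_nnsfun_approx.
- under eq_fun do rewrite nnsfun_approxE.
  by apply: (@cvg_approx _ _ _ setT (EFin \o f i)) => [y _||] //=;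
    rewrite ?lee_fin ?ltry.
- exact: mean_factors_simple.
Qed.

Lemma mean_factors_integrable (f : I -> R -> R) :
  (forall i, measurable_fun setT (f i)) ->
  (forall i, P.-integrable setT (EFin \o (f i \o Y i))) -> mean_factors f.
Proof.
move=> mf intf.
pose sign (b : bool) : R := if b then 1 else -1.
pose part i (b : bool) : R -> R := if b then (f i)^\+ else (f i)^\-.
have intpart i b : P.-integrable setT (EFin \o (part i b \o Y i)).
  by case: b; [exact: (integrable_funrpos measurableT (intf i))|
               exact: (integrable_funrneg measurableT (intf i))].
have -> : f = fun i x => \sum_b sign b * part i b x.
  apply/funext => i; apply/funext => x; rewrite big_bool /= mul1r mulN1r.
  by rewrite -[in LHS](funrposBneg (f i)).
apply: mean_factors_sum => [i b|h].
  exact: (integrableZl measurableT (sign b) (intpart i b)).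
apply: mean_factorsZ => //; apply: ge0_mean_factors => [i|i x|//].
- by rewrite /part; case: ifP; [move=> _; exact: measurable_funrpos|
    move=> _; exact: measurable_funrneg].
- by rewrite /part; case: ifP.
Qed.

End independence.

(** * Gaussian and Rademacher moments *)

Section density.
Context {d : measure_display} {T : measurableType d} {R : realType}.
Variables (nu : {finite_measure set T -> \bar R}).
Variables (mu : {sigma_finite_measure set T -> \bar R}) (h : T -> R).
Hypotheses (mh : measurable_fun setT h) (h0 : forall x, 0 <= h x).
Hypothesis nuE : forall A, measurable A -> (nu A = \int[mu]_(x in A) (h x)%:E)%E.

Lemma ge0_integral_density (f : T -> \bar R) :
  measurable_fun setT f -> (forall x, 0 <= f x)%E ->
  (\int[nu]_x f x = \int[mu]_x (f x * (h x)%:E))%E.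
Proof.
move=> mf f0; have mhE : measurable_fun setT (EFin \o h) by exact/measurable_EFinP.
have nu_mu : nu `<< mu.
  apply/null_content_dominatesP => A mA muA0; rewrite nuE//.
  by apply: null_set_integral => //; exact: measurable_funTS.
pose g := Radon_Nikodym_SigmaFinite.f nu mu.
have intg : mu.-integrable setT g by exact: Radon_Nikodym_SigmaFinite.f_integrable.
rewrite -(Radon_Nikodym_SigmaFinite.change_of_variables nu_mu)//.
apply: ae_eq_integral => //.
- by apply: emeasurable_funM => //; exact: measurable_int intg.
- exact: emeasurable_funM.
apply: ae_eqe_mul2l; apply: integral_ae_eq => // A _ mA.
by rewrite -Radon_Nikodym_SigmaFinite.f_integral// -nuE.
Qed.

End density.

Section law.
Context {d d' : measure_display} {T : measurableType d} {U : measurableType d'}.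
Context {R : realType} (mu : {measure set T -> \bar R}) (nu : {measure set U -> \bar R}).
Variable Y : T -> U.
Hypothesis mY : measurable_fun setT Y.
Hypothesis lawY : forall B, measurable B -> mu (Y @^-1` B) = nu B.

Lemma ge0_integral_eq_law (f : U -> \bar R) :
  measurable_fun setT f -> (forall u, 0 <= f u)%E ->
  (\int[mu]_t f (Y t) = \int[nu]_u f u)%E.
Proof.
move=> mf f0.
have f0' : {in [set: U], forall u, 0 <= f u}%E by move=> u _; exact: f0.
apply: (etrans (esym (ge0_integral_pushforward mY mu measurableT mf f0'))).
by apply: eq_measure_integral => B mB _; exact: lawY.
Qed.

Lemma integrable_eq_law (f : U -> \bar R) : nu.-integrable setT f ->
  mu.-integrable setT (f \o Y).
Proof.
move=> /integrableP[mf intf]; apply/integrableP; split.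
  exact: (measurableT_comp mf mY).
rewrite (@ge0_integral_eq_law (abse \o f)) => [//||u]; last exact: abse_ge0.
exact: measurableT_comp.
Qed.

Lemma integral_eq_law (f : U -> \bar R) : nu.-integrable setT f ->
  (\int[mu]_t f (Y t) = \int[nu]_u f u)%E.
Proof.
move=> intf; have mf := measurable_int _ intf; have intfY := integrable_eq_law intf.
apply: (etrans (esym (integral_pushforward mY mf intfY measurableT))).
by apply: eq_measure_integral => B mB _; exact: lawY.
Qed.

End law.

Lemma expR_ge_sum (R : realType) (x : R) n : 0 <= x ->
  \sum_(0 <= i < n) x ^+ i / i`!%:R <= expR x.
Proof.
move=> x0; apply: nondecreasing_cvgn_le (is_cvg_series_exp_coeff x) n.
by apply/nondecreasing_seqP => n; rewrite seriesSr lerDl; exact: exp_coeff_ge0.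
Qed.

Section normal_law.
Context {R : realType}.
Local Notation N := (@normal_prob R 0 1).

Lemma ge0_integral_normal (m s : R) (f : R -> \bar R) :
  measurable_fun setT f -> (forall x, 0 <= f x)%E ->
  (\int[normal_prob m s]_x f x =
   \int[lebesgue_measure]_x (f x * (normal_pdf m s x)%:E))%E.
Proof.
apply: (@ge0_integral_density _ _ R (normal_prob m s) lebesgue_measure) => //.
exact: measurable_normal_pdf.
Qed.

Lemma normal_probN (B : set R) : measurable B -> N (-%R @^-1` B) = N B.
Proof.
move=> mB; rewrite /normal_prob [LHS]integral_mkcond [RHS]integral_mkcond.
have lebesgueN := @ge0_integral_eq_law _ _ _ _ _ lebesgue_measure lebesgue_measure -%R.
rewrite -[RHS]lebesgueN//.
- apply: eq_integral => x _; rewrite !patchE !normal_pdfE ?oner_neq0//.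
  by rewrite /normal_fun !subr0 sqrrN.
- exact: lebesgue_measureN.
- apply/(measurable_restrictT _ mB)/measurable_funTS/measurable_EFinP.
  exact: measurable_normal_pdf.
- by apply: erestrict_ge0 => x _; rewrite lee_fin normal_pdf_ge0.
Qed.

Lemma Rintegral_normal_odd (f : R -> R) : N.-integrable setT (EFin \o f) ->
  (forall x, f (- x) = - f x) -> \int[N]_x f x = 0.
Proof.
move=> intf oddf.
suff : \int[N]_x f x = - \int[N]_x f x by lra.
rewrite -mulN1r -RintegralZl//; under [RHS]eq_Rintegral do rewrite mulN1r -oddf.
congr fine; rewrite -[LHS](@integral_eq_law _ _ _ _ _ N N -%R)//.
exact: normal_probN.
Qed.

Definition gauss_tilt (s : R) : R := (1 - s ^- 2) / 2.

(* Multiplying the standard normal density by [expR (gauss_tilt s * x ^+ 2)] gives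
   [s] times the centered normal density of standard deviation [s]. *)
Lemma integral_expR_sqr_normal (s : R) : 0 < s ->
  (\int[N]_x (expR (gauss_tilt s * x ^+ 2))%:E = s%:E)%E.
Proof.
move=> s0; have s_neq0 : s != 0 by rewrite gt_eqF.
rewrite ge0_integral_normal; last 2 first.
- apply/measurable_EFinP; apply: measurableT_comp => //.
  exact: measurable_funM.
- by move=> x; rewrite lee_fin expR_ge0.
transitivity (\int[lebesgue_measure]_x (s%:E * (normal_pdf 0 s x)%:E))%E.
  apply: eq_integral => x _; rewrite -!EFinM mulrC; congr EFin.
  rewrite !normal_pdfE ?oner_neq0// /normal_peak /normal_fun !subr0.
  rewrite expr1n mul1r -mulrnAr sqrtrM ?sqr_ge0// sqrtr_sqr gtr0_norm//.
  rewrite [in RHS]invfM !(mulrA s) divff// mul1r -[LHS]mulrA -expRD.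
  by congr (_ * expR _); rewrite /gauss_tilt -[1 *+ 2]/2 -mulr_natr; field.
rewrite ge0_integralZl_EFin ?integral_normal_pdf ?mule1 ?ltW//.
- by move=> x _; rewrite lee_fin; exact: normal_pdf_ge0.
- by apply/measurable_EFinP; exact: measurable_normal_pdf.
Qed.

End normal_law.

Lemma integrable_exprn_le (d : measure_display) (T : measurableType d) (R : realType)
    (mu : {finite_measure set T -> \bar R}) (Y : T -> R) (m n : nat) :
  measurable_fun setT Y -> (n <= m)%N ->
  mu.-integrable setT (EFin \o (fun t => Y t ^+ m)) ->
  mu.-integrable setT (EFin \o (fun t => Y t ^+ n)).
Proof.
move=> mY nm intYm.
apply: (@le_integrable _ _ _ mu _ measurableT _ (fun t => 1 + `|(Y t ^+ m)%:E|)%E).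
- exact/measurable_EFinP/measurable_funX.
- move=> t _ /=; rewrite lee_fin !normrX [leRHS]ger0_norm ?addr_ge0 ?exprn_ge0//.
  have [Y1|/ltW Y1] := leP `|Y t| 1.
    by rewrite (@le_trans _ _ 1) ?exprn_ile1// lerDl exprn_ge0.
  by rewrite (@le_trans _ _ (`|Y t| ^+ m)) ?ler_weXn2l// lerDr.
- apply: integrableD => //; last exact: integrable_abse.
  exact: finite_measure_integrable_cst.
Qed.

Section moments.
Context {R : realType} {dT : measure_display} {T : measurableType dT}.
Variables (P : probability T R) (Y : T -> R).

Definition moment n : R := \int[P]_t (Y t ^+ n).

Lemma moment0 : moment 0 = 1.
Proof.
rewrite /moment; under eq_Rintegral do rewrite expr0.
by rewrite Rintegral_cst// mul1r; exact: (congr1 fine (probability_setT P)).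
Qed.

Lemma moment_even_ge0 n : ~~ odd n -> 0 <= moment n.
Proof. by move=> n_even; apply: Rintegral_ge0 => t _; exact: exprn_even_ge0. Qed.

Record moments_le_normal : Prop := {
  measurable_moments : measurable_fun setT Y;
  integrable_moment4 : P.-integrable setT (EFin \o (fun t => Y t ^+ 4));
  moment1_eq0 : moment 1 = 0;
  moment3_eq0 : moment 3 = 0;
  moment2_le1 : moment 2 <= 1;
  moment4_le3 : moment 4 <= 3 }.

End moments.

Section normal_moments.
Context {R : realType}.
Local Notation N := (@normal_prob R 0 1).
Local Notation m_ := (moment N id).

Lemma integrable_expR_sqr_normal (s : R) : 0 < s ->
  N.-integrable setT (EFin \o (fun x => expR (gauss_tilt s * x ^+ 2))).
Proof.
move=> s0; apply/integrableP; split.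
  by apply/measurable_EFinP; apply: measurableT_comp => //; exact: measurable_funM.
under eq_integral do rewrite /= ger0_norm ?expR_ge0//.
by rewrite integral_expR_sqr_normal ?ltry.
Qed.

Lemma integrable_exprn_normal n : N.-integrable setT (EFin \o (fun x => x ^+ n)).
Proof.
apply: (@integrable_exprn_le _ _ _ N id (2 * n.+1)) => //.
  by rewrite mulSn addSnnS leq_addr.
have tilt_gt0 : 0 < gauss_tilt (2 : R) by rewrite /gauss_tilt; lra.
pose scale : R := gauss_tilt 2 ^- n.+1 * n.+1`!%:R.
apply: (@le_integrable _ _ _ N _ measurableT _
  (EFin \o (fun x => scale * expR (gauss_tilt 2 * x ^+ 2)))).
- exact/measurable_EFinP/measurable_funX.
- move=> x _; rewrite lee_fin [leRHS]ger0_norm; last first.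
    by rewrite !mulr_ge0 ?invr_ge0 ?exprn_ge0 ?expR_ge0// ltW.
  rewrite exprM ger0_norm; last exact/exprn_ge0/sqr_ge0.
  rewrite -mulrA ler_pdivlMl ?exprn_gt0// -ler_pdivrMl ?ltr0n ?fact_gt0//.
  rewrite -exprMn mulrC.
  apply: (le_trans _ (@expR_ge1Dxn _ (gauss_tilt 2 * x ^+ 2) n _)); first by rewrite lerDr.
  by rewrite mulr_ge0 ?sqr_ge0 ?ltW.
- exact: (integrableZl measurableT scale (integrable_expR_sqr_normal _)).
Qed.

Lemma normal_moment_odd n : odd n -> m_ n = 0.
Proof.
move=> n_odd; apply: Rintegral_normal_odd; first exact: integrable_exprn_normal.
by move=> x; rewrite exprNn -signr_odd n_odd expr1 mulN1r.
Qed.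

(* Truncations of the exponential series bound the even moments; letting [s] tend to 1
   makes the resulting bounds on the second and fourth moments sharp. *)
Lemma normal_even_moments_le n (s : R) : 0 < s ->
  (forall x, \sum_(0 <= i < n) (gauss_tilt s * x ^+ 2) ^+ i / i`!%:R <=
    expR (gauss_tilt s * x ^+ 2)) ->
  \sum_(0 <= i < n) gauss_tilt s ^+ i / i`!%:R * m_ (2 * i) <= s.
Proof.
move=> s0 exp_ge; pose coeff i := gauss_tilt s ^+ i / i`!%:R.
have intE i : N.-integrable setT (EFin \o (fun x => coeff i * x ^+ (2 * i))).
  exact: (integrableZl measurableT _ (integrable_exprn_normal _)).
have sumE x : \sum_(0 <= i < n) (gauss_tilt s * x ^+ 2) ^+ i / i`!%:R =
    \sum_(0 <= i < n) coeff i * x ^+ (2 * i).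
  by apply: eq_bigr => i _; rewrite exprMn -exprM mulrAC.
rewrite -[leRHS]/(fine s%:E) -integral_expR_sqr_normal//.
rewrite (eq_bigr (fun i => \int[N]_x (coeff i * x ^+ (2 * i)))); last first.
  by move=> i _; rewrite RintegralZl//; exact: integrable_exprn_normal.
rewrite -Rintegral_sum//; apply: le_Rintegral => // [| |x _].
- exact: integrable_sum_EFin.
- exact: integrable_expR_sqr_normal.
- by rewrite -sumE.
Qed.

Lemma normal_moment2_bounds (s : R) : 0 < s ->
  (1 < s -> (s + 1) * m_ 2 <= 2 * s ^+ 2) /\
  (s < 1 -> 2 * s ^+ 2 <= (s + 1) * m_ 2).
Proof.
move=> s0.
have mean_le : 1 + gauss_tilt s * m_ 2 <= s.
  have := @normal_even_moments_le 2 s s0.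
  rewrite !big_nat_recl// !big_geq// !addr0 !expr0 !expr1 !divr1 mul1r moment0.
  apply=> x; rewrite !big_nat_recl// big_geq// addr0 expr0 expr1 !divr1.
  exact: expR_ge1Dx.
have le_s : (s - 1) * ((s + 1) * m_ 2) <= (s - 1) * (2 * s ^+ 2).
  have -> : (s - 1) * ((s + 1) * m_ 2) = 2 * s ^+ 2 * (gauss_tilt s * m_ 2).
    by rewrite /gauss_tilt; field; rewrite gt_eqF.
  by rewrite [leRHS]mulrC ler_pM2l ?lerBrDl// mulr_gt0 ?exprn_gt0.
split=> s1; move: le_s.
- by rewrite ler_pM2l ?subr_gt0.
- by rewrite ler_nM2l ?subr_lt0.
Qed.

Lemma normal_moment2 : m_ 2 = 1.
Proof.
apply/eqP; rewrite eq_le; apply/andP; split; apply/ler_addgt0Pr => e e0.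
  have [s0 s1] : 0 < 1 + e / 2 /\ 1 < 1 + e / 2 by split; lra.
  have [/(_ s1) + _] := normal_moment2_bounds s0.
  by set m2 := m_ 2; nra.
have [e1|e1] := leP 1 e; first by rewrite ler_wpDl ?moment_even_ge0.
have [s0 s1] : 0 < 1 - e / 2 /\ 1 - e / 2 < 1 by split; lra.
have [_ /(_ s1)] := normal_moment2_bounds s0.
by set m2 := m_ 2; nra.
Qed.

Lemma normal_moment4_bound (s : R) : 1 < s ->
  (s + 1) ^+ 2 * m_ 4 <= 4 * s ^+ 2 * (2 * s + 1).
Proof.
move=> s1; have s0 : 0 < s by lra.
have tilt_ge0 : 0 <= gauss_tilt s.
  by rewrite divr_ge0// subr_ge0 invf_le1 ?exprn_gt0// exprn_ege1 ?ltW.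
have mean_le : 1 + gauss_tilt s + gauss_tilt s ^+ 2 / 2 * m_ 4 <= s.
  have := @normal_even_moments_le 3 s s0.
  rewrite !big_nat_recl// !big_geq// !addr0 !expr0 !expr1 !divr1 mul1r moment0.
  rewrite normal_moment2 mulr1 addrA; apply => x.
  by apply: expR_ge_sum; rewrite mulr_ge0 ?sqr_ge0.
rewrite -(@ler_pM2l _ ((s - 1) ^+ 2)) ?exprn_gt0 ?subr_gt0//.
have -> : (s - 1) ^+ 2 * ((s + 1) ^+ 2 * m_ 4) =
    8 * s ^+ 4 * (gauss_tilt s ^+ 2 / 2 * m_ 4).
  by rewrite /gauss_tilt; field; rewrite gt_eqF.
have -> : (s - 1) ^+ 2 * (4 * s ^+ 2 * (2 * s + 1)) =
    8 * s ^+ 4 * (s - (1 + gauss_tilt s)).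
  by rewrite /gauss_tilt; field; rewrite gt_eqF.
by rewrite ler_pM2l ?lerBrDl// mulr_gt0 ?exprn_gt0.
Qed.

Lemma normal_moment4_le3 : m_ 4 <= 3.
Proof.
apply/ler_addgt0Pr => e e0; have s1 : 1 < 1 + e / 8 by lra.
by have := normal_moment4_bound s1; set m4 := m_ 4; nra.
Qed.

Lemma moments_le_normal_normal_prob : moments_le_normal N id.
Proof.
split=> //; [exact: integrable_exprn_normal|exact: normal_moment_odd|
  exact: normal_moment_odd|by rewrite normal_moment2|exact: normal_moment4_le3].
Qed.

End normal_moments.

Section gaussian.
Context {R : realType} {dT : measure_display} {T : measurableType dT}.
Variables (P : probability T R) (Y : T -> R).
Hypotheses (mY : measurable_fun setT Y) (gaussY : std_gaussian P Y).

Lemma moment_gaussian n : moment P Y n = moment (normal_prob 0 1) id n.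
Proof.
congr fine.
exact: (integral_eq_law (nu := normal_prob 0 1) mY gaussY (integrable_exprn_normal n)).
Qed.

Lemma moments_le_normal_gaussian : moments_le_normal P Y.
Proof.
have [_ int4 ? ? ? ?] := @moments_le_normal_normal_prob R.
split; rewrite ?moment_gaussian//.
exact: (integrable_eq_law (nu := normal_prob 0 1) mY gaussY int4).
Qed.

End gaussian.

Section rademacher.
Context {R : realType} {dT : measure_display} {T : measurableType dT}.
Variables (P : probability T R) (Y : T -> R).
Hypotheses (mY : measurable_fun setT Y) (radY : rademacher P Y).

Local Notation level x := (Y @^-1` [set x]).

Let measurable_level (x : R) : measurable (level x).
Proof. exact: measurable_preimageT. Qed.

Let oner_neqN1 : 1 <> -1 :> R.
Proof. by move=> /eqP; rewrite -subr_eq0 opprK (pnatr_eq0 R 2). Qed.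

Lemma rademacher_ae : {ae P, forall t, Y t = 1 \/ Y t = -1}.
Proof.
exists (~` (level 1 `|` level (-1))); split => [| |t /= Yt [] //].
- by apply: measurableC; exact: measurableU.
- have disj : level 1 `&` level (-1) = set0 by apply/seteqP; split=> // t [/= ->].
  have [P1 PN1] := radY.
  rewrite probability_setC ?measureU//; last exact: measurableU.
  by rewrite [X in (_ - (X + _))%E]P1 [X in (_ - (_ + X))%E]PN1 -EFinD -splitr subrr.
- by move=> Yt'; apply: Yt; left.
- by move=> Yt'; apply: Yt; right.
Qed.

Lemma integral_rademacher (f : R -> R) : measurable_fun setT f ->
  (\int[P]_t (f (Y t))%:E = ((f 1 + f (-1)) / 2)%:E)%E.
Proof.
move=> mf; have [P1 PN1] := radY.
pose g x t := f x * \1_(level x) t.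
have intg x : P.-integrable setT (EFin \o g x).
  exact: (integrableZl measurableT _ (integrable_indic P (measurable_level x))).
have gE x : (\int[P]_t (g x t)%:E = (f x)%:E * P (level x))%E.
  under eq_integral do rewrite EFinM.
  rewrite integralZl//; last exact: integrable_indic.
  by rewrite integral_indic// setIT.
transitivity (\int[P]_t ((g 1 t)%:E + (g (-1) t)%:E))%E; last first.
  rewrite integralD//; [rewrite !gE|exact: intg|exact: intg].
  rewrite [X in (_ * X + _)%E]P1 [X in (_ + _ * X)%E]PN1.
  by rewrite -!EFinM -EFinD; congr EFin; field.
apply: ae_eq_integral => //.
- by apply/measurable_EFinP; exact: measurableT_comp.
- by apply: emeasurable_funD; apply: measurable_int (intg _).
apply: filterS rademacher_ae => t + _; rewrite /g !indicE -EFinD => -[] Yt; congr EFin.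
- rewrite mem_set// memNset ?mulr1 ?mulr0 ?addr0 ?Yt//=.
  by rewrite Yt; exact: oner_neqN1.
- rewrite memNset; last by rewrite /= Yt => /esym.
  by rewrite mem_set// mulr1 mulr0 add0r Yt.
Qed.

Lemma moment_rademacher n : moment P Y n = (1 + (-1) ^+ n) / 2.
Proof.
rewrite /moment /Rintegral (integral_rademacher (f := fun x => x ^+ n))//=.
by rewrite expr1n.
Qed.

Lemma moments_le_normal_rademacher : moments_le_normal P Y.
Proof.
split=> //; try by rewrite moment_rademacher ?sqrrN ?expr1 ?expr1n; lra.
apply/integrableP; split; first exact/measurable_EFinP/measurable_funX.
under eq_integral do rewrite /= ger0_norm ?exprn_even_ge0//.
by rewrite (integral_rademacher (f := fun x => x ^+ 4)) ?ltry.
Qed.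

End rademacher.

(** * Second moment of a quadratic form *)

Lemma variance_le_Rintegral_sqr (d : measure_display) (T : measurableType d) (R : realType)
    (P : probability T R) (Q : T -> R) : measurable_fun setT Q ->
  P.-integrable setT (EFin \o (fun t => Q t ^+ 2)) ->
  (variance P Q <= (\int[P]_t (Q t ^+ 2))%:E)%E.
Proof.
move=> mQ intQ2.
have Q1 : Q \in Lfun P 1.
  apply/Lfun1_integrable.
  exact: (integrable_exprn_le (n := 1) mQ _ intQ2).
have QQ1 : (Q * Q) \in Lfun P 1 by exact/Lfun1_integrable.
have meanQQ : ('E_P[Q * Q] = (\int[P]_t (Q t ^+ 2))%:E)%E.
  by rewrite unlock fineK ?integrable_fin_num.
rewrite /variance covarianceE// meanQQ -(fineK (expectation_fin_num Q1)).
by rewrite -EFinM -EFinB lee_fin gerBl -expr2 sqr_ge0.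
Qed.

Section second_moment.
Context {R : realType} {dT : measure_display} {T : measurableType dT}.
Variables (P : probability T R) (n : nat) (A : 'M[R]_n) (V : T -> 'cV[R]_n).

Lemma measurable_quad_form : (forall p, measurable_fun setT (fun t => V t p 0)) ->
  measurable_fun setT (fun t => ((V t)^T *m A *m V t) 0 0).
Proof.
move=> mV; under eq_fun do rewrite quad_formE.
apply: measurable_sum => p; apply: measurable_sum => q.
by apply: measurable_funM => //; exact: measurable_funM.
Qed.

Variables (C : R) (K : 'I_n -> 'I_n -> 'I_n -> 'I_n -> R).
Hypothesis psdA : psd A.
Hypothesis intV : forall p q r s,
  P.-integrable setT (EFin \o (fun t => V t p 0 * V t q 0 * V t r 0 * V t s 0)).
Hypothesis meanV : forall p q r s,
  0 <= \int[P]_t (V t p 0 * V t q 0 * V t r 0 * V t s 0) <= K p q r s.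
Hypothesis K_bounded : l2_bounded C K.

Lemma integrable_sqr_quad_form :
  P.-integrable setT (EFin \o (fun t => ((V t)^T *m A *m V t) 0 0 ^+ 2)).
Proof.
under [X in EFin \o X]eq_fun do rewrite sqr_quad_formE.
apply: integrable_sum_EFin => // u.
exact: (integrableZl measurableT _ (intV _ _ _ _)).
Qed.

Lemma Rintegral_sqr_quad_form_le :
  \int[P]_t (((V t)^T *m A *m V t) 0 0 ^+ 2) <= C * (\tr A) ^+ 2.
Proof.
pose a p := Num.sqrt (A p p).
have trE : l2norm a ^+ 2 = \tr A.
  by rewrite sqr_l2norm; apply: eq_bigr => p _; rewrite sqr_sqrtr// psd_diag_ge0.
have -> : C * \tr A ^+ 2 = C * (l2norm a * l2norm a * l2norm a * l2norm a).
  by rewrite -trE; ring.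
under eq_Rintegral do rewrite sqr_quad_formE.
rewrite Rintegral_sum//; last first.
  by move=> u; exact: (integrableZl measurableT _ (intV _ _ _ _)).
apply: le_trans (K_bounded a a a a); apply: ler_sum => -[[[p q] r] s] _ /=.
rewrite RintegralZl//.
have /andP[mean_ge0 mean_le] := meanV p q r s.
apply: (@le_trans _ _ (a p * a q * a r * a s *
    \int[P]_t (V t p 0 * V t q 0 * V t r 0 * V t s 0))).
  rewrite ler_wpM2r// (le_trans (ler_norm _))// normrM -[leRHS]mulrA.
  by rewrite ler_pM// psd_entry_le.
by rewrite mulrC ler_wpM2r// !mulr_ge0 ?sqrtr_ge0.
Qed.

End second_moment.

Section kronecker_moments.
Context {R : realType} {dT : measure_display} {T : measurableType dT}.
Variables (P : probability T R) (d k : nat) (X : 'I_k -> T -> 'cV[R]_d).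
Hypothesis indepX :
  mutually_independent P (fun ij : 'I_k * 'I_d => fun t => X ij.1 t ij.2 0).
Hypothesis momentX : forall i j, moments_le_normal P (fun t => X i t j 0).

Local Notation V t := (kronv (fun i => X i t)).

Let mult (p q r s : 'I_(d ^ k)) (ij : 'I_k * 'I_d) :=
  multiplicity (digit p ij.1) (digit q ij.1) (digit r ij.1) (digit s ij.1) ij.2.

Lemma measurable_kronv p : measurable_fun setT (fun t => V t p 0).
Proof.
under eq_fun do rewrite kronvE.
by apply: measurable_prod => i _; exact: measurable_moments (momentX i _).
Qed.

Lemma kronv_prod4E t p q r s : V t p 0 * V t q 0 * V t r 0 * V t s 0 =
  \prod_ij X ij.1 t ij.2 0 ^+ mult p q r s ij.
Proof.
rewrite !kronvE -!big_split/= -(pair_bigA _ (fun i j =>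
  X i t j 0 ^+ mult p q r s (i, j))).
by apply: eq_bigr => i _; rewrite (prod_multiplicity (fun j => X i t j 0)).
Qed.

Lemma kronv_mean_factors p q r s : mean_factors P
  (fun (ij : 'I_k * 'I_d) t => X ij.1 t ij.2 0) (fun ij x => x ^+ mult p q r s ij).
Proof.
apply: mean_factors_integrable => // [ij|ij].
- exact: measurable_moments (momentX ij.1 ij.2).
- have [mX int4 _ _ _ _] := momentX ij.1 ij.2.
  exact: (integrable_exprn_le mX (multiplicity_le4 _ _ _ _ _) int4).
Qed.

Lemma integrable_kronv_prod4 p q r s :
  P.-integrable setT (EFin \o (fun t => V t p 0 * V t q 0 * V t r 0 * V t s 0)).
Proof.
under [Z in EFin \o Z]eq_fun do rewrite kronv_prod4E.
by have [] := kronv_mean_factors p q r s.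
Qed.

Lemma Rintegral_kronv_prod4_le p q r s :
  0 <= \int[P]_t (V t p 0 * V t q 0 * V t r 0 * V t s 0) <=
  \prod_i pairings (digit p i) (digit q i) (digit r i) (digit s i).
Proof.
under eq_Rintegral do rewrite kronv_prod4E.
have [_ ->] := kronv_mean_factors p q r s.
pose mom i j := moment P (fun t => X i t j 0).
rewrite -(pair_bigA _ (fun i j => mom i j (mult p q r s (i, j)))) /mult/=.
have mom0 i j : mom i j 0 = 1 by exact: moment0.
have mom1 i j : mom i j 1 = 0 by exact: moment1_eq0.
have mom2 i j : 0 <= mom i j 2 <= 1 by rewrite moment_even_ge0//= moment2_le1.
have mom3 i j : mom i j 3 = 0 by exact: moment3_eq0.
have mom4 i j : 0 <= mom i j 4 <= 3 by rewrite moment_even_ge0//= moment4_le3.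
have prod_ge0 i := prod_moments_ge0 (mom0 i) (mom1 i) (mom2 i) (mom3 i) (mom4 i).
have prod_le i := prod_moments_le_pairings (mom0 i) (mom1 i) (mom2 i) (mom3 i) (mom4 i).
rewrite prodr_ge0 => [|i _]; last exact: prod_ge0.
by apply: ler_prod => i _; rewrite prod_ge0 prod_le.
Qed.

End kronecker_moments.

Theorem theorem4 (R : realType) (dT : measure_display) (T : measurableType dT)
    (P : probability T R) (d k : nat) (A : 'M[R]_(d ^ k))
    (gauss : 'I_k -> bool) (X : 'I_k -> T -> 'cV[R]_d) :
  psd A ->
  (forall (i : 'I_k) (j : 'I_d), measurable_fun setT (fun t => X i t j 0)) ->
  mutually_independent P (fun ij : 'I_k * 'I_d => fun t => X ij.1 t ij.2 0) ->
  (forall (i : 'I_k) (j : 'I_d),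
     if gauss i then std_gaussian P (fun t => X i t j 0)
     else rademacher P (fun t => X i t j 0)) ->
  (variance P (fun t => ((kronv (fun i => X i t))^T *m A *m kronv (fun i => X i t)) 0 0)%R
     <= ((3 ^+ k * \tr A) ^+ 2)%:E)%E.
Proof.
move=> psdA mX indepX distX.
have momentX i j : moments_le_normal P (fun t => X i t j 0).
  by have := distX i j; case: (gauss i); [exact: moments_le_normal_gaussian|
    exact: moments_le_normal_rademacher].
have intV := integrable_kronv_prod4 indepX momentX.
have meanV := Rintegral_kronv_prod4_le indepX momentX.
have mQ := measurable_quad_form A (measurable_kronv momentX).
apply: le_trans (variance_le_Rintegral_sqr mQ (integrable_sqr_quad_form A intV)) _.
rewrite lee_fin exprMn.
apply: le_trans (Rintegral_sqr_quad_form_le psdA intV meanV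
  (@l2_bounded_digit_pairings d R k)) _.
rewrite ler_wpM2r ?sqr_ge0// -exprM muln2 -addnn.
by rewrite ler_weXn2l ?leq_addr// ler1n.
Qed.
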